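(* Consider a run of LSQRNS (as described in the context) in which outer cycles $1,\dots,n$ converge with stopping tolerance $\varepsilon>0$. For $1\le m\le n$ define $$\vartheta_m=\max_{1\le j\le m}\angle(\mathcal{N}_\epsilon,y_j),\qquad \delta_m=\max_{1\le j\le m}\Delta_{i_j}.$$ Suppose that $\vartheta_n<\frac{\pi}{2}$, $\delta_n\epsilon^2\le 1$, and $$\varepsilon<\frac{1}{\kappa\tan\vartheta_n}\left(\frac{1-\delta_n\epsilon^2}{n-1}-2\sqrt{\delta_n}\,\epsilon\right).$$ Then, for $m=1,\dots,n$, $$\|\sin\angle(\mathcal{N}_\epsilon,\mathcal{X}_m)\|_F\le\frac{\sqrt{m}\,\kappa\,\varepsilon}{\sqrt{1-(m-1)\left(\dfrac{\tan\vartheta_m}{1-\delta_m\epsilon^2}\,\kappa\varepsilon+\dfrac{2\sqrt{\delta_m}\,\epsilon}{1-\delta_m\epsilon^2}\right)}}.$$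
   Context: Matrix setting. $A\in\mathbb{R}^{M\times N}$ is nonzero with singular values $\sigma_1\ge\dots\ge\sigma_N\ge 0$ (nonnegative square roots of the eigenvalues of $A^TA$). Fix $1\le\ell<N$ with $\sigma_\ell>\sigma_{\ell+1}$ and put $n=N-\ell$, $\kappa=\sigma_1/\sigma_\ell$, $\epsilon=\sigma_{\ell+1}/\sigma_1$ (distinct from the tolerance $\varepsilon$). Let $[W_\ell,W_\epsilon]\in\mathbb{R}^{N\times N}$ be an orthogonal matrix of right singular vectors, $W_\ell$ having $\ell$ columns: $A^TA=W_\ell\Sigma_\ell^2W_\ell^T+W_\epsilon\Sigma_\epsilon^2W_\epsilon^T$ with $\Sigma_\ell=\mathrm{diag}(\sigma_1,\dots,\sigma_\ell)$, $\Sigma_\epsilon=\mathrm{diag}(\sigma_{\ell+1},\dots,\sigma_N)$. The numerical null space of $A$ is $\mathcal{N}_\epsilon=\mathrm{span}(W_\epsilon)$, of dimension $n$; also $\mathcal{R}_\ell=\mathrm{span}(W_\ell)$. $\|\cdot\|$ is the Euclidean/spectral norm and $\|\cdot\|_F$ the Frobenius norm. For nonzero $v$, $\angle(\mathcal{N}_\epsilon,v)\in[0,\pi/2]$ with $\sin\angle(\mathcal{N}_\epsilon,v)=\|W_\ell^Tv\|/\|v\|$. For a subspace $\mathcal{X}$ with orthonormal basis matrix $X$ and $\dim\mathcal{X}\le n$, $\angle(\mathcal{N}_\epsilon,\mathcal{X})$ denotes the (diagonal matrix of) canonical angles, so $\|\sin\angle(\mathcal{N}_\epsilon,\mathcal{X})\|=\|W_\ell^TX\|$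 and $\|\sin\angle(\mathcal{N}_\epsilon,\mathcal{X})\|_F=\|W_\ell^TX\|_F$. LSQRNV (exact arithmetic). Started from a unit vector $y$, its $i$th iterate is $x_i=y-A^Tz_i$, where $z_i$ minimizes $\|y-A^T\tilde z\|$ over $\tilde z\in\mathrm{span}\{Ay,(AA^T)Ay,\dots,(AA^T)^{i-1}Ay\}$. It converges at the first $i\geq 1$ for which $x_i\ne 0$ and $\|Ax_i\|\le\|A\|\|x_i\|\varepsilon$. LSQRNS. $X_0$ is empty. For $m=1,2,\dots,n$: (i) take a vector $\hat y_m\in\mathbb{R}^N$ (a realization of a random vector with mean $0$ and covariance $\gamma I$, $\gamma>0$) with $\bar y_m=(I-X_{m-1}X_{m-1}^T)\hat y_m\ne0$, and set $y_m=\bar y_m/\|\bar y_m\|$; (ii) run LSQRNV from $y=y_m$ until convergence; let $i_m$ be the number of iterations needed, $x_{i_m}$ the final iterate and $\tilde x_m=x_{i_m}/\|x_{i_m}\|$; (iii) set $x_m^{\mathrm c}=\frac{(I-X_{m-1}X_{m-1}^T)\tilde x_m}{\|(I-X_{m-1}X_{m-1}^T)\tilde x_m\|}$ and $X_m=[X_{m-1},x_m^{\mathrm c}]$; $\mathcal{X}_m=\mathrm{span}(X_m)$. Definition of $\Delta_{i_j}$. For a starting vector $y$ and index $i$, let $\Psi_i$ be the set of real polynomials $\psi$ of degree $\le i$ with $\psi(0)=1$. Let $\psi_i\in\Psi_i$ minimize $\|\psi(A^TA/\sigma_1^2)y\|$ over $\Psi_i$ (so $x_i=\psi_i(A^TA/\sigma_1^2)y$)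 and, with $g_\ell=W_\ell^Ty$, let $\widehat\psi_i\in\Psi_i$ be a fixed minimizer of $\|\psi(\Sigma_\ell^2/\sigma_1^2)g_\ell\|$ over $\Psi_i$. Write $\psi_i(\varsigma)=1+\varsigma\phi_i(\varsigma)$, $\widehat\psi_i(\varsigma)=1+\varsigma\hat\phi_i(\varsigma)$ with $\phi_i,\hat\phi_i$ polynomials of degree $\le i-1$, and set $\Delta_i=\max\{\max_{0\le\varsigma\le\epsilon^2}|\phi_i(\varsigma)|,\max_{0\le\varsigma\le\epsilon^2}|\hat\phi_i(\varsigma)|\}$. Then $\Delta_{i_j}$ is this quantity for $y=y_j$ and $i=i_j$. Conventions. If $n=1$ the displayed upper bound on $\varepsilon$ is vacuous; a positive number divided by $0$ is $+\infty$; for $m=1$ the term multiplied by $m-1$ is $0$. *)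

(* Defs.v *)
From mathcomp Require Import all_boot all_order all_algebra.
From mathcomp Require Import all_classical all_reals all_analysis.

Set Implicit Arguments.
Unset Strict Implicit.
Unset Printing Implicit Defensive.

Import Order.TTheory GRing.Theory Num.Theory.

Local Open Scope classical_set_scope.
Local Open Scope ring_scope.

(* Sequences of singular values, angles, vectors and iteration counts are
   indexed from 1, as functions on nat; their values outside the relevant range
   (in particular at 0) are irrelevant. *)

Section Norms.
Variable R : realType.

Definition fnorm (p q : nat) (B : 'M[R]_(p, q)) : R :=
  Num.sqrt (\sum_i \sum_j B i j ^+ 2).

Definition enorm (p : nat) (v : 'cV[R]_p) : R := Num.sqrt (\sum_i v i 0 ^+ 2).

(* Spectral norm: the operator norm induced by the Euclidean norms. The unit
   ball rather than the unit sphere keeps the set nonempty when q = 0. *)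
Definition opnorm (p q : nat) (B : 'M[R]_(p, q)) : R :=
  sup [set enorm (B *m v) | v in [set v : 'cV[R]_q | enorm v <= 1]].

(* Yields 0 when v = 0. *)
Definition normalize (p : nat) (v : 'cV[R]_p) : 'cV[R]_p := (enorm v)^-1 *: v.

End Norms.

Section SingularValuesAndAngles.
Variable R : realType.

(* sigma 1 >= ... >= sigma q >= 0 are the nonnegative square roots of the
   eigenvalues of B^T B, counted with multiplicity. *)
Definition singular_values (p q : nat) (B : 'M[R]_(p, q)) (sigma : nat -> R) :
    Prop :=
  [/\ forall i, (1 <= i <= q)%N -> 0 <= sigma i,
      forall i j, (1 <= i)%N -> (i <= j)%N -> (j <= q)%N -> sigma j <= sigma i
    & char_poly (B^T *m B) = \prod_(1 <= i < q.+1) ('X - (sigma i ^+ 2)%:P)].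

(* The canonical angles between the column spaces of P and Q, for P and Q with
   orthonormal columns and q <= p: their cosines are the singular values of
   P^T Q. *)
Definition canonical_angles (N p q : nat) (P : 'M[R]_(N, p))
    (Q : 'M[R]_(N, q)) (theta : nat -> R) : Prop :=
  (forall i, (1 <= i <= q)%N -> 0 <= theta i <= pi / 2) /\
  singular_values (P^T *m Q) (fun i => cos (theta i)).

(* The diagonal matrix of sines of angles theta 1, ..., theta q. *)
Definition sin_angles (q : nat) (theta : nat -> R) : 'M[R]_q :=
  diag_mx (\row_(i < q) sin (theta i.+1)).

(* The angle between a nonzero vector v and the orthogonal complement of the
   column space of Wl, for Wl with orthonormal columns. *)
Definition vector_angle (N l : nat) (Wl : 'M[R]_(N, l)) (v : 'cV[R]_N) : R :=
  asin (enorm (Wl^T *m v) / enorm v).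

End SingularValuesAndAngles.

Section ResidualPolynomials.
Variable R : realType.

(* p(B) for a square matrix of arbitrary size; horner_mx requires a size of the
   syntactic form N.+1 (see mxpolyE). *)
Definition mxpoly (N : nat) (p : {poly R}) (B : 'M[R]_N) : 'M[R]_N :=
  \sum_(k < size p) p`_k *: B ^+ k.

Lemma mxpolyE (N : nat) (p : {poly R}) (B : 'M[R]_N.+1) :
  mxpoly p B = horner_mx B p.
Proof.
rewrite /mxpoly -[in RHS](coefK p) poly_def rmorph_sum /=.
by apply: eq_bigr => k _; rewrite horner_mxZ rmorphXn /= horner_mx_X.
Qed.

(* The set Psi_i *)
Definition residual_poly (i : nat) (psi : {poly R}) : Prop :=
  (size psi <= i.+1)%N /\ psi.[0] = 1.

(* psi minimizes |psi(B) v| over Psi_i; the minimizing polynomial need not be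
   unique. *)
Definition minimal_residual_poly (N : nat) (B : 'M[R]_N) (v : 'cV[R]_N)
    (i : nat) (psi : {poly R}) : Prop :=
  residual_poly i psi /\
  forall q, residual_poly i q ->
    enorm (mxpoly psi B *m v) <= enorm (mxpoly q B *m v).

(* The polynomial phi such that psi = 1 + 'X * phi, when psi(0) = 1. *)
Definition phi_of (psi : {poly R}) : {poly R} := (psi - 1) %/ 'X.

Definition max_abs_on (a b : R) (p : {poly R}) : R :=
  sup [set `|p.[t]| | t in `[a, b]].

Definition Delta (eps : R) (psi psih : {poly R}) : R :=
  Num.max (max_abs_on 0 (eps ^+ 2) (phi_of psi))
          (max_abs_on 0 (eps ^+ 2) (phi_of psih)).

End ResidualPolynomials.

Section Algorithms.
Variables (R : realType) (M N : nat).
Implicit Types (A : 'M[R]_(M, N)) (y x : 'cV[R]_N).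

(* span {A y, (A A^T) A y, ..., (A A^T)^(i-1) A y} *)
Definition krylov A y (i : nat) : {vspace 'cV[R]_M} :=
  <<[seq (A *m A^T) ^+ k *m (A *m y) | k <- iota 0 i]>>%VS.

Definition lsqrnv_iterate A y (i : nat) x : Prop :=
  exists z : 'cV[R]_M,
    [/\ z \in krylov A y i,
        forall z', z' \in krylov A y i ->
          enorm (y - A^T *m z) <= enorm (y - A^T *m z')
      & x = y - A^T *m z].

Definition stopping_test A (tol : R) x : Prop :=
  x != 0 /\ enorm (A *m x) <= opnorm A * enorm x * tol.

(* LSQRNV started from y converges after exactly i iterations, with final
   iterate x. *)
Definition lsqrnv_converges A (tol : R) y (i : nat) x : Prop :=
  [/\ (1 <= i)%N, lsqrnv_iterate A y i x, stopping_test A tol x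
    & forall k x', (1 <= k < i)%N -> lsqrnv_iterate A y k x' ->
        ~ stopping_test A tol x'].

(* X_m = [xc 1, ..., xc m] *)
Definition basis_mx (xc : nat -> 'cV[R]_N) (m : nat) : 'M[R]_(N, m) :=
  \matrix_(i < N, j < m) xc j.+1 i 0.

(* I - X_m X_m^T *)
Definition deflation (xc : nat -> 'cV[R]_N) (m : nat) : 'M[R]_N :=
  1%:M - basis_mx xc m *m (basis_mx xc m)^T.

(* A run of LSQRNS whose outer cycles 1, ..., n all converge. The vectors
   yhat m are the realizations of the random vectors. *)
Definition lsqrns_run A (tol : R) (n : nat)
    (yhat y x xt xc : nat -> 'cV[R]_N) (it : nat -> nat) : Prop :=
  forall m, (1 <= m <= n)%N ->
    [/\ deflation xc m.-1 *m yhat m != 0,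
        y m = normalize (deflation xc m.-1 *m yhat m),
        lsqrnv_converges A tol (y m) (it m) (x m),
        xt m = normalize (x m)
      & xc m = normalize (deflation xc m.-1 *m xt m)].

End Algorithms.

(* Main.v *)
Require Import Defs.
From mathcomp Require Import all_boot all_order all_algebra.
From mathcomp Require Import all_classical all_reals all_analysis.
From mathcomp Require Import ring lra.

Set Implicit Arguments.
Unset Strict Implicit.
Unset Printing Implicit Defensive.

Import Order.TTheory GRing.Theory Num.Theory.
Local Open Scope ring_scope.

(** Write H for A^T A divided by the square of the largest singular value, and
Hl and He for its diagonal blocks in the basis formed by Wl and We.  The final
iterates of the inner runs, normalized, are vectors xt_j; the basis X_m comes
from them by the Gram-Schmidt process.

Each xt_j is nearly in the numerical null space: the stopping test bounds
|A xt_j| and A expands Wl-components by at least the l-th singular value, so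
|Wl^T xt_j| <= kappa tol.  Hence the Frobenius norm of Wl^T [xt_1 ... xt_m] is
at most sqrt m kappa tol, and all that may be lost in passing to X_m is the
smallest singular value of [xt_1 ... xt_m].  By Gershgorin's argument its
square is at least 1 - (m - 1) beta as soon as the unit vectors xt_j have
mutual inner products at most beta ([gershgorin], [gram_schmidt_stable]).

The heart of the proof is the bound on these inner products
([overlap_bound]).  Let i < j, v = xt_i, and let x = psi(H) y be the final
iterate started from y = y_j.  Then v is orthogonal to y, so
<v, x> = <v, x - y>.  With g = Wl^T y and h = We^T y, the vector x - y differs
from - Wl (g - psih(Hl) g) by a defect z whose components are
(psi - psih)(Hl) g along Wl and psi(He) h - h along We.  The first part
contributes at most |Wl^T v| |g| <= kappa tol |g|, because psih(Hl) g is an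
orthogonal residual.  As for z, the optimality of psi tested against psih, and
of psih tested against psi, turns the unknown |(psi - psih)(Hl) g|^2 into
<psi(He) h, (psih - psi)(He) h>, which only involves We-components.  There both
polynomials are within D = delta eps^2 of 1, and summing over the components
gives |z|^2 <= 2 D |h|^2 ([residual_defect]).  Dividing by
|x| >= (1 - D) |h| yields
beta = (tan vartheta kappa tol + 2 sqrt D) / (1 - D).

The condition on the tolerance makes 1 - (m - 1) beta positive.  This also
shows that the Gram-Schmidt process does not break down, so X_m has
orthonormal columns, and the sum of the squared sines of its canonical angles
with We is then the squared Frobenius norm of Wl^T X_m
([fnorm_sin_angles]). *)

(** * Euclidean geometry and Gershgorin bounds *)

Section Euclidean.
Variable R : realType.

Definition dot (p : nat) (u v : 'cV[R]_p) : R := \sum_i u i 0 * v i 0.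

Lemma dotC p (u v : 'cV[R]_p) : dot u v = dot v u.
Proof. by apply: eq_bigr => i _; rewrite mulrC. Qed.

Lemma dotDl p (u v w : 'cV[R]_p) : dot (u + v) w = dot u w + dot v w.
Proof.
by rewrite /dot -big_split; apply: eq_bigr => i _; rewrite mxE mulrDl.
Qed.

Lemma dotZl p a (u v : 'cV[R]_p) : dot (a *: u) v = a * dot u v.
Proof. by rewrite /dot mulr_sumr; apply: eq_bigr => i _; rewrite mxE mulrA. Qed.

Lemma dotDr p (u v w : 'cV[R]_p) : dot w (u + v) = dot w u + dot w v.
Proof. by rewrite dotC dotDl ![dot _ w]dotC. Qed.

Lemma dotZr p a (u v : 'cV[R]_p) : dot v (a *: u) = a * dot v u.
Proof. by rewrite dotC dotZl dotC. Qed.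

Lemma dotNl p (u v : 'cV[R]_p) : dot (- u) v = - dot u v.
Proof. by rewrite -scaleN1r dotZl mulN1r. Qed.

Lemma dotNr p (u v : 'cV[R]_p) : dot v (- u) = - dot v u.
Proof. by rewrite dotC dotNl dotC. Qed.

Lemma dot0l p (v : 'cV[R]_p) : dot 0 v = 0.
Proof. by rewrite -(scale0r v) dotZl mul0r. Qed.

Lemma dot0r p (v : 'cV[R]_p) : dot v 0 = 0.
Proof. by rewrite dotC dot0l. Qed.

Definition dotE := (dotDl, dotDr, dotNl, dotNr, dotZl, dotZr).

Lemma dot_sumr p (I : finType) (P : pred I) (u : 'cV[R]_p) (F : I -> 'cV[R]_p) :
  dot u (\sum_(i | P i) F i) = \sum_(i | P i) dot u (F i).
Proof.
by apply: (big_morph (dot u)) => [v w|]; rewrite ?dotDr ?dot0r.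
Qed.

Lemma dot_suml p (I : finType) (P : pred I) (u : 'cV[R]_p) (F : I -> 'cV[R]_p) :
  dot (\sum_(i | P i) F i) u = \sum_(i | P i) dot (F i) u.
Proof. by rewrite dotC dot_sumr; apply: eq_bigr => i _; rewrite dotC. Qed.

Lemma dot_mx p (u v : 'cV[R]_p) : dot u v = (u^T *m v) 0 0.
Proof. by rewrite mxE; apply: eq_bigr => i _; rewrite mxE. Qed.

Lemma dot_adjl p q (B : 'M[R]_(p, q)) u v : dot (B *m u) v = dot u (B^T *m v).
Proof. by rewrite !dot_mx trmx_mul mulmxA. Qed.

Lemma dot_adjr p q (B : 'M[R]_(p, q)) u v : dot v (B *m u) = dot (B^T *m v) u.
Proof. by rewrite dotC dot_adjl dotC. Qed.

Lemma dotvv_ge0 p (u : 'cV[R]_p) : 0 <= dot u u.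
Proof. by apply: sumr_ge0 => i _; rewrite -expr2 sqr_ge0. Qed.

Lemma dotvv_eq0 p (u : 'cV[R]_p) : dot u u = 0 -> u = 0.
Proof.
move=> u0; apply/matrixP => i j; rewrite ord1 mxE.
have /psumr_eq0P h : forall i : 'I_p, true -> 0 <= u i 0 * u i 0.
  by move=> k _; rewrite -expr2 sqr_ge0.
by have /eqP := h u0 i isT; rewrite mulf_eq0 orbb => /eqP.
Qed.

Lemma enorm_ge0 p (u : 'cV[R]_p) : 0 <= enorm u.
Proof. exact: sqrtr_ge0. Qed.

Lemma enormE p (u : 'cV[R]_p) : enorm u = Num.sqrt (dot u u).
Proof. by congr Num.sqrt; apply: eq_bigr => i _; rewrite expr2. Qed.

Lemma enorm_sqr p (u : 'cV[R]_p) : enorm u ^+ 2 = dot u u.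
Proof. by rewrite sqr_sqrtr //; apply: sumr_ge0 => i _; rewrite sqr_ge0. Qed.

Lemma enorm_eq0 p (u : 'cV[R]_p) : (enorm u == 0) = (u == 0).
Proof.
apply/eqP/eqP => [u0|->]; last first.
  by apply/eqP; rewrite -(sqrf_eq0 (enorm _)) enorm_sqr dot0l.
by apply: dotvv_eq0; rewrite -enorm_sqr u0 expr0n.
Qed.

Lemma enorm_gt0 p (u : 'cV[R]_p) : (0 < enorm u) = (u != 0).
Proof. by rewrite lt_def enorm_ge0 andbT enorm_eq0. Qed.

Lemma ler_enorm p q (u : 'cV[R]_p) (v : 'cV[R]_q) a : 0 <= a ->
  dot u u <= a ^+ 2 * dot v v -> enorm u <= a * enorm v.
Proof.
move=> a0; rewrite -!enorm_sqr -exprMn => h.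
by rewrite -ler_sqr ?nnegrE ?mulr_ge0 ?enorm_ge0.
Qed.

Lemma dot_normalize p (v : 'cV[R]_p) : v != 0 ->
  dot (normalize v) (normalize v) = 1.
Proof.
rewrite -enorm_eq0 => v0.
by rewrite /normalize !dotE -enorm_sqr; field.
Qed.

Lemma normalizeK p (v : 'cV[R]_p) : enorm v *: normalize v = v.
Proof.
rewrite /normalize scalerA.
have [->|v0] := eqVneq v 0; first by rewrite scaler0.
by rewrite mulfV ?enorm_eq0 // scale1r.
Qed.

Lemma cauchy_schwarz p (u v : 'cV[R]_p) :
  dot u v ^+ 2 <= dot u u * dot v v.
Proof.
have [/dotvv_eq0 ->|v0] := eqVneq (dot v v) 0.
  by rewrite !dot0r expr0n mulr0.
have vp : 0 < dot v v by rewrite lt_def v0 dotvv_ge0.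
have := dotvv_ge0 (dot v v *: u - dot u v *: v).
rewrite !dotE (dotC v u) => h.
rewrite -subr_ge0 -(pmulr_rge0 _ vp); apply: le_trans h _.
lra.
Qed.

Lemma normr_dot_le p (u v : 'cV[R]_p) : `|dot u v| <= enorm u * enorm v.
Proof.
rewrite -ler_sqr ?nnegrE ?mulr_ge0 ?enorm_ge0 // exprMn !enorm_sqr.
by rewrite real_normK ?num_real // cauchy_schwarz.
Qed.

(** Pythagoras: an orthogonal residual w leaves u - w, the projection of u, no
longer than u. *)
Lemma enorm_sub_orth p (u w : 'cV[R]_p) : dot w (u - w) = 0 ->
  enorm (u - w) <= enorm u.
Proof.
rewrite -(ler_sqr (enorm_ge0 _) (enorm_ge0 _)) !enorm_sqr !dotE (dotC u w).
by have := dotvv_ge0 w; lra.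
Qed.

Lemma fnorm_sqr p q (B : 'M[R]_(p, q)) :
  fnorm B ^+ 2 = \sum_j dot (col j B) (col j B).
Proof.
rewrite sqr_sqrtr; last first.
  by apply: sumr_ge0 => i _; apply: sumr_ge0 => j _; exact: sqr_ge0.
rewrite exchange_big; apply: eq_bigr => j _; apply: eq_bigr => i _.
by rewrite !mxE expr2.
Qed.

Lemma fnorm_trmx p q (B : 'M[R]_(p, q)) : fnorm B^T = fnorm B.
Proof.
rewrite /fnorm exchange_big; congr Num.sqrt.
by apply: eq_bigr => i _; apply: eq_bigr => j _; rewrite mxE.
Qed.

Lemma fnorm_sqr_trace p q (B : 'M[R]_(p, q)) : fnorm B ^+ 2 = \tr (B^T *m B).
Proof.
rewrite fnorm_sqr; apply: eq_bigr => j _; rewrite mxE.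
by apply: eq_bigr => i _; rewrite !mxE.
Qed.

Lemma injective_unitmx m (T : 'M[R]_m) :
  (forall z : 'cV_m, T *m z = 0 -> z = 0) -> T \in unitmx.
Proof.
move=> inj; rewrite -unitmx_tr -row_free_unit -kermx_eq0.
apply/eqP/row_matrixP => i; rewrite row0; apply: trmx_inj; rewrite trmx0.
apply: inj; rewrite -[X in X *m _]trmxK -trmx_mul.
by rewrite (sub_kermxP (row_sub i _)) trmx0.
Qed.

(** A square matrix and its transpose have the same smallest singular value.
The proof avoids singular values: T is invertible, so w = T u for some u, and
the Cauchy-Schwarz inequality for |w|^2 = <T^T w, u> combines with
mu |u|^2 <= |w|^2. *)
Lemma lower_bound_tr m (T : 'M[R]_m) (mu : R) : 0 < mu ->
  (forall z, mu * dot z z <= dot (T *m z) (T *m z)) ->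
  forall z, mu * dot z z <= dot (T^T *m z) (T^T *m z).
Proof.
move=> mu0 hT w.
have uT : T \in unitmx.
  apply: injective_unitmx => z Tz0; apply: dotvv_eq0; apply/eqP.
  have := hT z; rewrite Tz0 dot0l pmulr_rle0 // => h.
  by rewrite eq_le h dotvv_ge0.
have [w0|] := eqVneq (dot w w) 0; first by rewrite w0 mulr0 dotvv_ge0.
move=> w0; have wp : 0 < dot w w by rewrite lt_def w0 dotvv_ge0.
set z := invmx T *m w; have wE : w = T *m z by rewrite /z mulKVmx.
have := hT z; rewrite -wE => hz.
have := cauchy_schwarz (T^T *m w) z; rewrite dot_adjl trmxK -wE => hcs.
have h0 := dotvv_ge0 (T^T *m w).
rewrite -(ler_pM2r wp) -mulrA -expr2.
apply: le_trans (ler_wpM2l (ltW mu0) hcs) _.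
by rewrite mulrCA ler_wpM2l.
Qed.

(** T acts on the rows of B, that is, T^T on the columns of B^T; hence the need
for [lower_bound_tr]. *)
Lemma fnorm_mulmx_lower p m (B : 'M[R]_(p, m)) (T : 'M[R]_m) (mu : R) :
  0 < mu -> (forall z, mu * dot z z <= dot (T *m z) (T *m z)) ->
  mu * fnorm B ^+ 2 <= fnorm (B *m T) ^+ 2.
Proof.
move=> mu0 hT; rewrite -(fnorm_trmx B) -(fnorm_trmx (_ *m _)) trmx_mul.
rewrite !fnorm_sqr mulr_sumr; apply: ler_sum => j _.
rewrite [col j (_ *m _)]colE -mulmxA -colE.
exact: lower_bound_tr.
Qed.

(** The Gram matrix of the F i has unit diagonal and off-diagonal entries at
most beta, so Gershgorin's theorem bounds its eigenvalues below. *)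
Lemma gershgorin p m (F : 'I_m -> 'cV[R]_p) (beta : R) :
  (forall i, dot (F i) (F i) = 1) ->
  (forall i j, i != j -> `|dot (F i) (F j)| <= beta) ->
  forall z : 'cV[R]_m,
  (1 - (m%:R - 1) * beta) * dot z z <=
  dot (\sum_i z i 0 *: F i) (\sum_i z i 0 *: F i).
Proof.
move=> h1 hb z.
have -> : dot (\sum_i z i 0 *: F i) (\sum_i z i 0 *: F i) =
    \sum_i \sum_j z i 0 * z j 0 * dot (F i) (F j).
  rewrite dot_suml; apply: eq_bigr => i _; rewrite dot_sumr.
  by apply: eq_bigr => j _; rewrite !dotE mulrA.
(* The arithmetic-geometric mean inequality bounds each off-diagonal term below
   by - beta (z_i^2 + z_j^2) / 2; the extra beta on the diagonal makes G one
   formula that is easy to sum. *)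
pose G i j : R := (if i == j then 1 + beta else 0) * z i 0 ^+ 2
  - beta * (z i 0 ^+ 2 / 2) - beta * (z j 0 ^+ 2 / 2).
have le_G (i j : 'I_m) : G i j <= z i 0 * z j 0 * dot (F i) (F j).
  rewrite /G; have [<-|ij] := eqVneq i j.
    rewrite h1; lra.
  have b0 : 0 <= beta := le_trans (normr_ge0 _) (hb i j ij).
  have : `|z i 0 * z j 0 * dot (F i) (F j)| <=
      beta * (z i 0 ^+ 2 / 2 + z j 0 ^+ 2 / 2).
    rewrite normrM mulrC; apply: ler_pM; rewrite ?normr_ge0 ?hb //.
    rewrite normrM -(real_normK (num_real (z i 0))).
    rewrite -(real_normK (num_real (z j 0))).
    have := sqr_ge0 (`|z i 0| - `|z j 0|); rewrite sqrrB; lra.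
  rewrite ler_norml => /andP[h _]; apply: le_trans h; rewrite mul0r; lra.
apply: le_trans (ler_sum _ (fun i _ => ler_sum _ (fun j _ => le_G i j))).
have sG (i : 'I_m) : \sum_j G i j = (1 + beta - beta * m%:R / 2) * z i 0 ^+ 2
    - beta / 2 * dot z z.
  rewrite /G !sumrB -mulr_suml -big_mkcond (big_pred1 i) => [|j]; last first.
    exact: eq_sym.
  rewrite sumr_const card_ord -[_ *+ m]mulr_natr -mulr_sumr -mulr_suml.
  have -> : \sum_j z j 0 ^+ 2 = dot z z by apply: eq_bigr => j _; rewrite expr2.
  by field.
rewrite (eq_bigr _ (fun i _ => sG i)) sumrB -mulr_sumr sumr_const card_ord.
have -> : \sum_j z j 0 ^+ 2 = dot z z by apply: eq_bigr => j _; rewrite expr2.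
rewrite -[_ *+ m]mulr_natr; lra.
Qed.

End Euclidean.

(** * Minimal residual polynomials *)

Section ResidualPolynomials.
Variable R : realType.

(** A common number of terms for polynomials of different degrees, from which
the linearity of [mxpoly] follows coefficientwise. *)
Lemma mxpoly_wide N (p : {poly R}) (B : 'M[R]_N) k : (size p <= k)%N ->
  mxpoly p B = \sum_(i < k) p`_i *: B ^+ i.
Proof.
move=> le_k; rewrite /mxpoly (big_ord_widen _ (fun i => p`_i *: B ^+ i) le_k).
rewrite big_mkcond; apply: eq_bigr => i _; case: ifPn => //.
by rewrite -leqNgt => le_i; rewrite nth_default // scale0r.
Qed.

Lemma mxpolyD N (p q : {poly R}) (B : 'M[R]_N) :
  mxpoly (p + q) B = mxpoly p B + mxpoly q B.
Proof.
have le_p := leq_maxl (size p) (size q).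
have le_q := leq_maxr (size p) (size q).
rewrite (mxpoly_wide B le_p) (mxpoly_wide B le_q).
rewrite (mxpoly_wide B (size_polyD p q)) -big_split.
by apply: eq_bigr => i _; rewrite coefD scalerDl.
Qed.

Lemma mxpolyZ N a (p : {poly R}) (B : 'M[R]_N) :
  mxpoly (a *: p) B = a *: mxpoly p B.
Proof.
rewrite (mxpoly_wide B (size_scale_leq a p)) /mxpoly scaler_sumr.
by apply: eq_bigr => i _; rewrite coefZ scalerA.
Qed.

Lemma mxpolyB N (p q : {poly R}) (B : 'M[R]_N) :
  mxpoly (p - q) B = mxpoly p B - mxpoly q B.
Proof. by rewrite mxpolyD -scaleN1r mxpolyZ scaleN1r. Qed.

Lemma mxpoly1 N (B : 'M[R]_N) : mxpoly 1 B = 1%:M.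
Proof. by rewrite /mxpoly size_poly1 big_ord1 coefC scale1r expr0. Qed.

Lemma mxpoly_intertwine N P (Q : 'M[R]_(P, N)) (B : 'M[R]_N) (C : 'M[R]_P) p :
  Q *m B = C *m Q -> Q *m mxpoly p B = mxpoly p C *m Q.
Proof.
move=> QB; rewrite /mxpoly mulmx_sumr mulmx_suml; apply: eq_bigr => i _.
rewrite -scalemxAr -scalemxAl; congr (_ *: _).
elim: {i}(nat_of_ord i) => [|k IHk]; first by rewrite !expr0 mulmx1 mul1mx.
by rewrite !exprS -!mulmxE mulmxA QB -!mulmxA -IHk.
Qed.

Lemma mxpoly_diag N (d : 'rV[R]_N) p (v : 'cV[R]_N) i :
  (mxpoly p (diag_mx d) *m v) i 0 = p.[d 0 i] * v i 0.
Proof.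
have pow k : diag_mx d ^+ k = diag_mx (\row_j d 0 j ^+ k).
  elim: k => [|k IHk].
    rewrite expr0 -[1]/(1%:M) -diag_const_mx; congr diag_mx.
    by apply/rowP => j; rewrite !mxE.
  rewrite exprS -mulmxE IHk mulmx_diag; congr diag_mx.
  by apply/rowP => j; rewrite !mxE exprS.
rewrite /mxpoly mulmx_suml summxE horner_coef mulr_suml.
apply: eq_bigr => k _.
by rewrite -scalemxAl pow mul_diag_mx !mxE mulrA.
Qed.

Lemma residual_poly_line i (p q : {poly R}) a :
  residual_poly i p -> residual_poly i q -> residual_poly i (p + a *: (q - p)).
Proof.
move=> [sp p1] [sq q1]; split; last first.
  by rewrite !hornerE p1 q1 subrr mulr0 addr0.
rewrite (leq_trans (size_polyD _ _)) // geq_max sp /=.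
rewrite (leq_trans (size_scale_leq _ _)) // (leq_trans (size_polyD _ _)) //.
by rewrite geq_max sq size_polyN.
Qed.

(** First-order optimality: Psi_i is an affine space, so the squared norm along
the line from psi to q is a quadratic with its minimum at psi, and its slope
there is zero. *)
Lemma minimal_residual_orth N (B : 'M[R]_N) v i psi q :
  minimal_residual_poly B v i psi -> residual_poly i q ->
  dot (mxpoly psi B *m v) (mxpoly q B *m v - mxpoly psi B *m v) = 0.
Proof.
move=> [rpsi min] rq.
move Eu : (mxpoly psi B *m v) => u; move Ew : (_ - u) => w.
have line a : 0 <= 2 * a * dot u w + a ^+ 2 * dot w w.
  have := min _ (residual_poly_line a rpsi rq).
  rewrite mxpolyD mxpolyZ mxpolyB mulmxDl -scalemxAl mulmxBl Eu Ew.
  rewrite -(ler_sqr (enorm_ge0 _) (enorm_ge0 _)) !enorm_sqr.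
  rewrite !dotE (dotC w u); lra.
have w0 := dotvv_ge0 w.
have p1 : 0 < dot w w + 1 by lra.
(* This step length makes the quadratic negative unless the slope is zero. *)
have := line (- dot u w / (dot w w + 1)).
have -> : 2 * (- dot u w / (dot w w + 1)) * dot u w +
    (- dot u w / (dot w w + 1)) ^+ 2 * dot w w =
    - (dot u w / (dot w w + 1)) ^+ 2 * (dot w w + 2).
  by field; rewrite gt_eqF.
rewrite mulNr oppr_ge0 pmulr_lle0; last lra.
move=> h; have : (dot u w / (dot w w + 1)) ^+ 2 == 0.
  by rewrite eq_le h sqr_ge0.
by rewrite sqrf_eq0 mulf_eq0 invr_eq0 (gt_eqF p1) orbF => /eqP.
Qed.

(** Minimizing polynomials may differ, but they produce the same vector. *)
Lemma minimal_residual_unique N (B : 'M[R]_N) v i psi q :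
  minimal_residual_poly B v i psi -> minimal_residual_poly B v i q ->
  mxpoly q B *m v = mxpoly psi B *m v.
Proof.
move=> mpsi mq; have := minimal_residual_orth mpsi (proj1 mq).
have := minimal_residual_orth mq (proj1 mpsi).
move: (mxpoly psi B *m v) (mxpoly q B *m v) => u w h1 h2.
apply/eqP; rewrite -subr_eq0; apply/eqP; apply: dotvv_eq0.
by move: h1 h2; rewrite !dotE (dotC w u); lra.
Qed.

(** The supremum in [max_abs_on] is over a bounded set: the sum of the absolute
values of the monomials at b is a bound. *)
Lemma max_abs_on_ge (p : {poly R}) b t : 0 <= t <= b ->
  `|p.[t]| <= max_abs_on 0 b p.
Proof.
move=> tb; apply: ub_le_sup; last by exists t => //=; rewrite in_itv.
exists (\sum_(k < size p) `|p`_k| * b ^+ k) => _ [s /= + <-].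
rewrite in_itv /= => /andP[s0 sb]; rewrite horner_coef.
apply: le_trans (ler_norm_sum _ _ _) _; apply: ler_sum => k _.
rewrite normrM normrX (ger0_norm s0) ler_wpM2l // lerXn2r ?nnegrE //.
exact: le_trans sb.
Qed.

Lemma max_abs_on_ge0 (p : {poly R}) b : 0 <= b -> 0 <= max_abs_on 0 b p.
Proof.
by move=> b0; apply: le_trans (@max_abs_on_ge p b 0 _); rewrite ?lexx.
Qed.

Lemma residual_poly_near1 i (p : {poly R}) b t : residual_poly i p ->
  0 <= t <= b -> `|p.[t] - 1| <= max_abs_on 0 b (phi_of p) * b.
Proof.
move=> [_ p1] tb.
have pE : p - 1 = phi_of p * 'X.
  rewrite divpK // -(subr0 'X) dvdp_XsubCl rootE.
  by rewrite !hornerE p1 subrr.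
have -> : p.[t] - 1 = (phi_of p).[t] * t by rewrite -hornerMX -pE !hornerE.
have /andP[t0 tb'] := tb.
by rewrite normrM (ger0_norm t0) ler_pM // max_abs_on_ge.
Qed.

End ResidualPolynomials.

(** * Inner products with a minimal residual *)

Section SplitResidual.
Variables (R : realType) (l n : nat).
Variables (Wl : 'M[R]_(l + n, l)) (We : 'M[R]_(l + n, n)).
Hypothesis orthW : (row_mx Wl We)^T *m row_mx Wl We = 1%:M.

Lemma orthW_blocks : [/\ Wl^T *m Wl = 1%:M, Wl^T *m We = 0, We^T *m Wl = 0
  & We^T *m We = 1%:M].
Proof.
move: orthW; rewrite tr_row_mx mul_col_row scalar_mx_block.
by move=> /eq_block_mx [].
Qed.

Lemma orthW_complete : Wl *m Wl^T + We *m We^T = 1%:M.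
Proof. by rewrite -mul_row_col -tr_row_mx; apply: mulmx1C. Qed.

Lemma dot_split (u v : 'cV[R]_(l + n)) :
  dot u v = dot (Wl^T *m u) (Wl^T *m v) + dot (We^T *m u) (We^T *m v).
Proof.
rewrite !dot_adjl !trmxK -dotDr !mulmxA -mulmxDl.
by rewrite orthW_complete mul1mx.
Qed.

Variables (H : 'M[R]_(l + n)) (Hl : 'M[R]_l) (d : 'rV[R]_n) (b : R).
Hypothesis intertwine_l : Wl^T *m H = Hl *m Wl^T.
Hypothesis intertwine_e : We^T *m H = diag_mx d *m We^T.
Hypothesis d_itv : forall i, 0 <= d 0 i <= b.

Variables (y : 'cV[R]_(l + n)) (i : nat) (psi psih : {poly R}) (delta : R).
Hypothesis psi_min : minimal_residual_poly H y i psi.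
Hypothesis psih_min : minimal_residual_poly Hl (Wl^T *m y) i psih.
Hypothesis psi_delta : max_abs_on 0 b (phi_of psi) <= delta.
Hypothesis psih_delta : max_abs_on 0 b (phi_of psih) <= delta.
Hypothesis b_ge0 : 0 <= b.
Hypothesis delta_lt1 : delta * b < 1.

Let g := Wl^T *m y.
Let h := We^T *m y.
Let x := mxpoly psi H *m y.

Lemma residual_proj_l p : Wl^T *m (mxpoly p H *m y) = mxpoly p Hl *m g.
Proof. by rewrite mulmxA (mxpoly_intertwine _ intertwine_l) -mulmxA. Qed.

Lemma residual_proj_e p : We^T *m (mxpoly p H *m y) = mxpoly p (diag_mx d) *m h.
Proof. by rewrite mulmxA (mxpoly_intertwine _ intertwine_e) -mulmxA. Qed.

Lemma residual_near1 p j : residual_poly i p ->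
  max_abs_on 0 b (phi_of p) <= delta ->
  1 - delta * b <= p.[d 0 j] <= 1 + delta * b.
Proof.
move=> rp lep; have := residual_poly_near1 rp (d_itv j).
rewrite ler_norml => /andP[h1 h2].
have : max_abs_on 0 b (phi_of p) * b <= delta * b by rewrite ler_wpM2r.
by move: h1 h2 => *; apply/andP; split; lra.
Qed.

(** The vector z measures how far x - y is from the projection step that psih
would take within the span of Wl alone.  Optimality of psi against psih and of
psih against psi gives |Wl^T z|^2 = <w, u - w> with w = psi(He) h and
u = psih(He) h, where He = diag_mx d, while We^T z = w - h.  Adding the
squares, the quadratic terms in w cancel and component j contributes
h_j^2 (1 - p (2 - q)) where p and q are the values of psi and psih at d_j; both
p and 2 - q are at least 1 - delta b. *)
Lemma residual_defect z : z = x - y + Wl *m (g - mxpoly psih Hl *m g) ->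
  dot z z <= 2 * (delta * b) * dot h h.
Proof.
move=> zE.
have [Wll _ Wel _] := orthW_blocks.
have zl : Wl^T *m z = mxpoly psi Hl *m g - mxpoly psih Hl *m g.
  by rewrite zE mulmxDr mulmxBr residual_proj_l mulmxA Wll mul1mx addrA subrK.
have ze : We^T *m z = mxpoly psi (diag_mx d) *m h - h.
  by rewrite zE mulmxDr mulmxBr residual_proj_e mulmxA Wel mul0mx addr0.
have orth1 := minimal_residual_orth psi_min (proj1 psih_min).
have orth2 := minimal_residual_orth psih_min (proj1 psi_min).
rewrite dot_split !mulmxBr !residual_proj_l !residual_proj_e in orth1.
rewrite dot_split zl ze.
(* The two optimality conditions combine: nothing bounds the polynomials on
   the spectrum of Hl, but the right side only involves values on [0, b]. *)
have -> : dot (mxpoly psi Hl *m g - mxpoly psih Hl *m g)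
    (mxpoly psi Hl *m g - mxpoly psih Hl *m g) =
    dot (mxpoly psi (diag_mx d) *m h)
      (mxpoly psih (diag_mx d) *m h - mxpoly psi (diag_mx d) *m h).
  move: orth1 orth2; rewrite -/g.
  move: (mxpoly psi Hl *m g) (mxpoly psih Hl *m g) => a c.
  by rewrite !dotE (dotC c a); lra.
rewrite /dot mulr_sumr -big_split; apply: ler_sum => j _ /=.
have subE (u v : 'cV[R]_n) : (u - v) j 0 = u j 0 - v j 0 by rewrite !mxE.
rewrite !subE !mxpoly_diag.
have /andP[p1 p2] := residual_near1 j (proj1 psi_min) psi_delta.
have /andP[q1 q2] := residual_near1 j (proj1 psih_min) psih_delta.
set p := psi.[_] in p1 p2 *; set q := psih.[_] in q1 q2 *.
set D := delta * b in p1 p2 q1 q2 *.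
have : (1 - D) * (1 - D) <= p * (2 - q).
  by have D1 : D < 1 := delta_lt1; apply: ler_pM; lra.
have := sqr_ge0 (h j 0); rewrite -/D => h2 pq.
have : 0 <= h j 0 ^+ 2 * (2 * D - 1 + p * (2 - q)).
  by apply: mulr_ge0 => //; have := sqr_ge0 D; lra.
lra.
Qed.

Lemma residual_ge : (1 - delta * b) * enorm h <= enorm x.
Proof.
have D1 : 0 <= 1 - delta * b by rewrite subr_ge0 ltW.
rewrite -ler_sqr ?nnegrE ?mulr_ge0 ?enorm_ge0 // exprMn !enorm_sqr.
rewrite (dot_split x) residual_proj_e; apply: ler_wpDl; first exact: dotvv_ge0.
rewrite /dot mulr_sumr; apply: ler_sum => j _; rewrite mxpoly_diag.
have /andP[p1 _] := residual_near1 j (proj1 psi_min) psi_delta.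
rewrite [leRHS]mulrACA -!expr2 ler_wpM2r ?sqr_ge0 // lerXn2r ?nnegrE //.
exact: le_trans p1.
Qed.

(** Since v is orthogonal to y, <v, x> = <v, z> - <Wl^T v, r> with r the
projection g - psih(Hl) g of g.  The two terms are at most
2 sqrt (delta b) |h| and k |g| <= k tau |h|, and |x| >= (1 - delta b) |h|. *)
Lemma overlap_bound v k tau : dot v v = 1 -> dot v y = 0 ->
  enorm (Wl^T *m v) <= k -> 0 < enorm h -> enorm g <= tau * enorm h ->
  `|dot v (normalize x)| <=
    (tau * k + 2 * Num.sqrt (delta * b)) / (1 - delta * b).
Proof.
move=> v1 vy vk h0 gh.
have D1 : 0 < 1 - delta * b by rewrite subr_gt0.
have D0 : 0 <= delta * b.
  by rewrite mulr_ge0 // (le_trans _ psi_delta) // max_abs_on_ge0.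
pose r := g - mxpoly psih Hl *m g.
pose z := x - y + Wl *m r.
have r_le : enorm r <= enorm g.
  (* The constant polynomial 1 is admissible, so psih(Hl) g is orthogonal to
     r. *)
  have r1 : @residual_poly R i 1.
    by split; rewrite ?size_poly1 ?hornerE.
  have := minimal_residual_orth psih_min r1; rewrite mxpoly1 mul1mx.
  exact: enorm_sub_orth.
have vx : dot v x = dot v z - dot (Wl^T *m v) r.
  by rewrite -dot_adjr /z !dotE vy; lra.
have z_le : enorm z <= 2 * Num.sqrt (delta * b) * enorm h.
  apply: ler_enorm; first by rewrite mulr_ge0 ?sqrtr_ge0.
  rewrite exprMn sqr_sqrtr //; apply: le_trans (residual_defect erefl) _.
  rewrite ler_wpM2r ?dotvv_ge0 //; lra.
have num_le : `|dot v x| <= (tau * k + 2 * Num.sqrt (delta * b)) * enorm h.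
  rewrite vx; apply: le_trans (ler_normB _ _) _.
  have := normr_dot_le v z; rewrite (enormE v) v1 sqrtr1.
  have := normr_dot_le (Wl^T *m v) r.
  have : enorm (Wl^T *m v) * enorm r <= k * (tau * enorm h).
    by rewrite ler_pM ?enorm_ge0 // (le_trans r_le).
  lra.
have x0 : 0 < enorm x.
  by apply: lt_le_trans residual_ge; rewrite mulr_gt0.
rewrite /normalize dotZr normrM gtr0_norm ?invr_gt0 // ler_pdivrMl //.
apply: (le_trans num_le).
set K := tau * k + _ in num_le *.
have K0 : 0 <= K by rewrite -(pmulr_lge0 _ h0) (le_trans _ num_le).
have -> : K * enorm h = (1 - delta * b) * enorm h * (K / (1 - delta * b)).
  by field; rewrite gt_eqF.
by rewrite ler_wpM2r ?residual_ge // divr_ge0 // ltW.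
Qed.

End SplitResidual.

(** * Krylov iterates as residual polynomials *)

Section KrylovPolynomials.
Variables (R : realType) (M N : nat) (A : 'M[R]_(M, N)) (y : 'cV[R]_N).
Variables (c : R) (i : nat).
Hypothesis c_neq0 : c != 0.

Definition krylov_gen (k : nat) : 'cV[R]_M := (A *m A^T) ^+ k *m (A *m y).

Lemma mulmx_krylov_gen k :
  A^T *m krylov_gen k = (A^T *m A) ^+ k.+1 *m y.
Proof.
have comm : A^T *m (A *m A^T) ^+ k = (A^T *m A) ^+ k *m A^T.
  elim: k => [|k IHk]; first by rewrite !expr0 mulmx1 mul1mx.
  by rewrite !exprS -!mulmxE -[RHS]mulmxA -IHk !mulmxA.
by rewrite /krylov_gen mulmxA comm exprSr -mulmxE !mulmxA.
Qed.

Lemma exprZmx k (B : 'M[R]_N) : (c *: B) ^+ k = c ^+ k *: B ^+ k.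
Proof.
elim: k => [|k IHk]; first by rewrite !expr0 scale1r.
by rewrite !exprS IHk -!mulmxE -scalemxAl -scalemxAr scalerA.
Qed.

(** With psi(0) = 1 the constant term of psi gives y, and each higher power of
A^T A applied to y is A^T times a Krylov generator; [krylov_residual] is the
converse. *)
Lemma mxpoly_krylov q : residual_poly i q ->
  mxpoly q (c *: (A^T *m A)) *m y =
  y - A^T *m \sum_(k < i) (- (q`_k.+1 * c ^+ k.+1)) *: krylov_gen k.
Proof.
move=> [sq q1]; rewrite (mxpoly_wide _ sq) mulmx_suml big_ord_recl.
rewrite expr0 -horner_coef0 q1 scale1r mul1mx; congr (_ + _).
rewrite mulmx_sumr -sumrN; apply: eq_bigr => k _.
rewrite -scalemxAr scaleNr opprK mulmx_krylov_gen exprZmx scalerA.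
by rewrite scalemxAl.
Qed.

Lemma krylov_residual z : z \in krylov A y i ->
  exists2 q, residual_poly i q &
    y - A^T *m z = mxpoly q (c *: (A^T *m A)) *m y.
Proof.
move=> zK.
have [a ->] : exists a : nat -> R, z = \sum_(k < i) a k *: krylov_gen k.
  have szX : size (map krylov_gen (iota 0 i)) == i.
    by rewrite size_map size_iota.
  have := @coord_span _ _ _ (Tuple szX) z zK => zE.
  exists (fun k => if insub k is Some o then coord (Tuple szX) o z else 0).
  rewrite [LHS]zE; apply: eq_bigr => k _; rewrite valK; congr (_ *: _).
  by rewrite (nth_map 0%N) ?size_iota // nth_iota.
exists (\poly_(k < i.+1) (if k is k'.+1 then - a k' * c ^- k else 1)).
  split; first exact: size_poly.
  by rewrite horner_coef0 coef_poly.
rewrite mxpoly_krylov; last first.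
  split; first exact: size_poly.
  by rewrite horner_coef0 coef_poly.
congr (_ - _ *m _); apply: eq_bigr => k _; congr (_ *: _).
rewrite coef_poly ltnS ltn_ord mulrAC.
by field; rewrite expf_neq0.
Qed.

(** Minimizing over the Krylov space is minimizing over Psi_i, and the minimal
vector is unique. *)
Lemma lsqrnv_iterateE x psi : lsqrnv_iterate A y i x ->
  minimal_residual_poly (c *: (A^T *m A)) y i psi ->
  x = mxpoly psi (c *: (A^T *m A)) *m y.
Proof.
move=> [z [zK zmin xE]] mpsi; have [q rq qE] := krylov_residual zK.
rewrite xE qE; apply: minimal_residual_unique mpsi _; split=> // p rp.
rewrite -qE (mxpoly_krylov rp); apply: zmin.
apply: memv_suml => k _; apply: memvZ; apply: memv_span.
by apply: (map_f krylov_gen); rewrite mem_iota add0n leq0n ltn_ord.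
Qed.

End KrylovPolynomials.

(** * Stability of the Gram-Schmidt process *)

Section BasisMatrix.
Variables (R : realType) (N : nat) (xc : nat -> 'cV[R]_N).

Lemma col_basis_mx (m : nat) (j : 'I_m) : col j (basis_mx xc m) = xc j.+1.
Proof. by apply/colP => i; rewrite !mxE. Qed.

Lemma mul_basis_mx (m : nat) (z : 'cV[R]_m) :
  basis_mx xc m *m z = \sum_(k < m) z k 0 *: xc k.+1.
Proof.
apply/colP => i; rewrite mxE summxE; apply: eq_bigr => k _.
by rewrite !mxE mulrC.
Qed.

Lemma mul_basis_mx_tr (m : nat) v (k : 'I_m) :
  ((basis_mx xc m)^T *m v) k 0 = dot (xc k.+1) v.
Proof. by rewrite mxE; apply: eq_bigr => i _; rewrite !mxE. Qed.

Lemma mul_deflation (m : nat) v :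
  deflation xc m *m v = v - \sum_(k < m) dot (xc k.+1) v *: xc k.+1.
Proof.
rewrite /deflation mulmxBl mul1mx -mulmxA mul_basis_mx; congr (_ - _).
by apply: eq_bigr => k _; rewrite mul_basis_mx_tr.
Qed.

Lemma basis_mx_gram (m : nat) (i j : 'I_m) :
  ((basis_mx xc m)^T *m basis_mx xc m) i j = dot (xc i.+1) (xc j.+1).
Proof. by rewrite mxE; apply: eq_bigr => k _; rewrite !mxE. Qed.

End BasisMatrix.

Section GramSchmidt.
Variables (R : realType) (N : nat) (xc : nat -> 'cV[R]_N).

(** Orthogonal vectors each of which is a unit vector or zero.  Zero is what
normalization returns when the process breaks down; allowing it makes the
property hold at every step, so that the absence of breakdown can be deduced
afterwards. *)
Definition weak_orthonormal (m : nat) : Prop :=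
  (forall i j, (1 <= i <= m)%N -> (1 <= j <= m)%N -> i != j ->
     dot (xc i) (xc j) = 0) /\
  (forall i, (1 <= i <= m)%N -> dot (xc i) (xc i) *: xc i = xc i).

Lemma deflation_orth m i v : weak_orthonormal m -> (1 <= i <= m)%N ->
  dot (xc i) (deflation xc m *m v) = 0.
Proof.
move=> [orth unit] im; rewrite mul_deflation dotDr dotNr dot_sumr.
case: i im => // i im; rewrite (bigD1 (Ordinal im)) //= big1 => [|k neq_ki].
  by rewrite addr0 dotZr mulrC -dotZl unit // subrr.
by rewrite dotZr orth ?mulr0 ?ltn_ord // eqSS eq_sym.
Qed.

Variables (n : nat) (xt : nat -> 'cV[R]_N).
Hypothesis gram_schmidt : forall m, (1 <= m <= n)%N ->
  xc m = normalize (deflation xc m.-1 *m xt m).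

Lemma gram_schmidt_weak_orthonormal m : (m <= n)%N -> weak_orthonormal m.
Proof.
elim: m => [|m IHm] le_mn; first by split=> i; case: i.
have om := IHm (ltnW le_mn); have [orth unit] := om.
have xcE : xc m.+1 = normalize (deflation xc m *m xt m.+1).
  exact: gram_schmidt.
have new i : (1 <= i <= m)%N -> dot (xc i) (xc m.+1) = 0.
  by move=> im; rewrite xcE dotZr deflation_orth ?mulr0.
split=> [i j /andP[i1]|i /andP[i1]].
  rewrite leq_eqVlt => /predU1P[->|im] /andP[j1].
    rewrite leq_eqVlt => /predU1P[->|jm]; first by rewrite eqxx.
    by rewrite dotC new // j1.
  rewrite leq_eqVlt => /predU1P[->|jm] ij; first by rewrite new // i1.
  by rewrite orth ?i1 ?j1.
rewrite leq_eqVlt => /predU1P[->|im]; last by rewrite unit // i1.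
rewrite xcE; set v := _ *m _; have [->|v0] := eqVneq v 0.
  by rewrite /normalize !scaler0.
by rewrite dot_normalize // scale1r.
Qed.

(** In effect xt j lies in the span of xc 1, ..., xc j, being the sum of a
multiple of xc j and of its projection on the earlier vectors. *)
Lemma orth_gram_schmidt m u j : (m <= n)%N ->
  (forall i, (1 <= i <= m)%N -> dot (xc i) u = 0) -> (1 <= j <= m)%N ->
  dot (xt j) u = 0.
Proof.
move=> le_mn orth /andP[j1 jm].
have := mul_deflation xc j.-1 (xt j).
rewrite -[deflation _ _ *m _]normalizeK -gram_schmidt ?j1 ?(leq_trans jm) //.
move/eqP; rewrite eq_sym subr_eq => /eqP ->.
rewrite dotDl dotZl orth ?j1 // mulr0 add0r dot_suml big1 // => k _.
rewrite dotZl orth ?mulr0 //= (leq_trans _ jm) //.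
exact: leq_trans (ltn_ord k) (leq_pred j).
Qed.

Lemma deflation_gram_schmidt m j : (m <= n)%N -> (1 <= j <= m)%N ->
  deflation xc m *m xt j = 0.
Proof.
move=> le_mn jm; have om := gram_schmidt_weak_orthonormal le_mn.
have orth i : (1 <= i <= m)%N -> dot (xc i) (deflation xc m *m xt j) = 0.
  exact: deflation_orth.
apply: dotvv_eq0; rewrite {1}mul_deflation dotDl dotNl dot_suml.
rewrite (orth_gram_schmidt le_mn orth) // big1 ?subrr // => k _.
by rewrite dotZl orth ?mulr0 //= ltn_ord.
Qed.

Lemma gram_schmidt_factor m : (m <= n)%N ->
  basis_mx xt m = basis_mx xc m *m ((basis_mx xc m)^T *m basis_mx xt m).
Proof.
move=> le_mn; apply/eqP; rewrite -subr_eq0 mulmxA -[X in X - _]mul1mx -mulmxBl.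
rewrite -/(deflation xc m); apply/eqP/matrixP => i j.
have := deflation_gram_schmidt le_mn (ltn_ord j : 1 <= j.+1 <= m)%N.
rewrite -col_basis_mx colE mulmxA -colE => /colP/(_ i).
by rewrite [LHS]mxE [RHS]mxE => ->; rewrite mxE.
Qed.

(** Orthonormalizing Xt = [xt 1, ..., xt m] costs at most the smallest singular
value of Xt.  Write Xt = X T with T = X^T Xt; injectivity of Xt passes to T,
which is square, then to X, so that no column of X is zero and X is
orthonormal.  Then T inherits the lower bound of Xt, and
B X = (B Xt) T^-1. *)
Lemma gram_schmidt_stable m (mu : R) : (m <= n)%N -> 0 < mu ->
  (forall z, mu * dot z z <= dot (basis_mx xt m *m z) (basis_mx xt m *m z)) ->
  (basis_mx xc m)^T *m basis_mx xc m = 1%:M /\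
  forall p (B : 'M[R]_(p, N)),
    mu * fnorm (B *m basis_mx xc m) ^+ 2 <= fnorm (B *m basis_mx xt m) ^+ 2.
Proof.
move=> le_mn mu0 lower; have XtE := gram_schmidt_factor le_mn.
have [orth unit] := gram_schmidt_weak_orthonormal le_mn.
set X := basis_mx xc m in XtE *; set T := X^T *m _ in XtE.
have uT : T \in unitmx.
  apply: injective_unitmx => z Tz0; apply: dotvv_eq0; apply/eqP.
  rewrite eq_le dotvv_ge0 andbT -(pmulr_rle0 _ mu0) (le_trans (lower z)) //.
  by rewrite XtE -mulmxA Tz0 mulmx0 dot0l.
have X1 : X^T *m X = 1%:M.
  apply/matrixP => i j; rewrite basis_mx_gram mxE.
  have [<-|ij] := eqVneq i j; last by rewrite orth ?ltn_ord.
  have /eqP := unit i.+1 (ltn_ord i).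
  rewrite -subr_eq0 -{4}[xc i.+1]scale1r -scalerBl scaler_eq0 subr_eq0.
  case/orP => [/eqP //|/eqP xi0].
  have : X *m delta_mx i 0 = 0 :> 'cV_N by rewrite -colE col_basis_mx.
  rewrite -[delta_mx i 0](mulKVmx uT) (mulmxA X) -XtE => Xt0.
  have := lower (invmx T *m delta_mx i 0); rewrite Xt0 dot0l pmulr_rle0 // => h.
  have /dotvv_eq0 h0 :
      dot (invmx T *m delta_mx i 0) (invmx T *m delta_mx i 0) = 0.
    by apply/eqP; rewrite eq_le h dotvv_ge0.
  have /colP/(_ i) : delta_mx i 0 = 0 :> 'cV[R]_m.
    by rewrite -[LHS](mulKVmx uT) h0 mulmx0.
  by rewrite !mxE !eqxx => /eqP; rewrite oner_eq0.
split=> // p B; rewrite XtE mulmxA; apply: fnorm_mulmx_lower => // z.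
apply: le_trans (lower z) _.
by rewrite XtE -mulmxA dot_adjl mulmxA X1 mul1mx.
Qed.

End GramSchmidt.

(** * Canonical angles and angles of vectors *)

Section Angles.
Variable R : realType.

(** The coefficient below the leading one of the characteristic polynomial is
minus the trace. *)
Lemma singular_values_trace p m (B : 'M[R]_(p, m)) (s : nat -> R) :
  singular_values B s -> \sum_(i < m) s i.+1 ^+ 2 = \tr (B^T *m B).
Proof.
case: m B => [|m] B [_ _ char]; first by rewrite big_ord0 /mxtrace big_ord0.
have := char_poly_trace (B^T *m B) (ltn0Sn m).
pose r := [seq s i ^+ 2 | i <- index_iota 1 m.+2].
have szr : size r = m.+1 by rewrite size_map size_iota subn1.
have -> : char_poly (B^T *m B) = \prod_(a <- r) ('X - a%:P).
  by rewrite char big_map.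
have := @coefPn_prod_XsubC _ r; rewrite szr => -> // /oppr_inj <-.
by rewrite big_map big_add1 big_mkord.
Qed.

(** The squared cosines sum to |We^T X|_F^2, and |We^T X|_F^2 + |Wl^T X|_F^2 is
the number m of orthonormal columns of X. *)
Lemma fnorm_sin_angles N l p m (Wl : 'M[R]_(N, l)) (We : 'M[R]_(N, p))
    (X : 'M[R]_(N, m)) theta :
  Wl *m Wl^T + We *m We^T = 1%:M -> X^T *m X = 1%:M ->
  canonical_angles We X theta ->
  fnorm (sin_angles m theta) ^+ 2 = fnorm (Wl^T *m X) ^+ 2.
Proof.
move=> complete X1 [_ /singular_values_trace cosE].
rewrite !fnorm_sqr_trace /sin_angles tr_diag_mx mulmx_diag mxtrace_diag.
have -> : \tr ((Wl^T *m X)^T *m (Wl^T *m X)) =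
    m%:R - \tr ((We^T *m X)^T *m (We^T *m X)).
  apply/eqP; rewrite eq_sym subr_eq -raddfD !trmx_mul !trmxK !mulmxA.
  by rewrite -!(mulmxA X^T) -mulmxDr -mulmxDl complete mul1mx X1 /= mxtrace1.
rewrite -cosE; apply/eqP; rewrite eq_sym subr_eq -big_split /=.
rewrite (eq_bigr (fun=> 1)) ?sumr_const ?card_ord // => i _.
by rewrite !mxE -expr2 addrC cos2Dsin2.
Qed.

(** Monotonicity of the tangent without division by cos a: it restates
sin (b - a) >= 0. *)
Lemma sin_le_tan_cos (a b : R) : - (pi / 2) < a -> a <= b -> b < pi / 2 ->
  sin a <= tan b * cos a.
Proof.
move=> a1 ab b1.
have cb : 0 < cos b by apply: cos_gt0_pihalf; rewrite b1 andbT (lt_le_trans a1).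
have : 0 <= sin (b - a) by apply: sin_ge0_pi; apply/andP; split; lra.
rewrite sinB /tan => h.
rewrite -(ler_pM2l cb) mulrAC mulrCA mulfV ?gt_eqF // mulr1; lra.
Qed.

Lemma ler_tan (a b : R) : - (pi / 2) < a -> a <= b -> b < pi / 2 ->
  tan a <= tan b.
Proof.
move=> a1 ab b1; rewrite {1}/tan ler_pdivrMr ?sin_le_tan_cos //.
by apply: cos_gt0_pihalf; rewrite a1 (le_lt_trans ab).
Qed.

Lemma enormZ p a (v : 'cV[R]_p) : enorm (a *: v) = `|a| * enorm v.
Proof.
by rewrite !enormE !dotE mulrA -expr2 sqrtrM ?sqr_ge0 // sqrtr_sqr.
Qed.

Lemma vector_angle_tan l n (Wl : 'M[R]_(l + n, l)) (We : 'M[R]_(l + n, n))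
    (y : 'cV[R]_(l + n)) (t : R) :
  (row_mx Wl We)^T *m row_mx Wl We = 1%:M -> dot y y = 1 ->
  vector_angle Wl y <= t -> t < pi / 2 ->
  0 < enorm (We^T *m y) /\ enorm (Wl^T *m y) <= tan t * enorm (We^T *m y).
Proof.
move=> orthW y1; rewrite /vector_angle.
have -> : enorm y = 1 by rewrite enormE y1 sqrtr1.
rewrite divr1; set s := enorm (Wl^T *m y) => st t1.
have pyth : s ^+ 2 + enorm (We^T *m y) ^+ 2 = 1.
  by rewrite !enorm_sqr -(dot_split orthW).
have s0 : 0 <= s := enorm_ge0 _.
have s1 : s <= 1.
  rewrite -(@ler_pXn2r _ 2%N) ?nnegrE // expr1n -pyth lerDl; exact: sqr_ge0.
have a1 : - (pi / 2) < asin s by apply: asin_gtNpi2; rewrite s1 andbT; lra.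
have cosE : cos (asin s) = enorm (We^T *m y).
  rewrite cos_asin; last by rewrite s1 andbT; lra.
  rewrite -pyth [_ + _ - _]addrAC subrr add0r.
  by rewrite sqrtr_sqr ger0_norm // enorm_ge0.
have sinE : sin (asin s) = s by rewrite asinK // in_itv /= s1 andbT; lra.
rewrite -cosE -{2}sinE; split; last exact: sin_le_tan_cos.
by apply: cos_gt0_pihalf; rewrite a1 (le_lt_trans st).
Qed.

End Angles.

(** * The truncated singular value decomposition *)

Section TruncatedSVD.
Variables (R : realType) (M l n : nat) (A : 'M[R]_(M, l + n)).
Variables (Wl : 'M[R]_(l + n, l)) (We : 'M[R]_(l + n, n)).
Variables (dl : 'rV[R]_l) (de : 'rV[R]_n).
Hypothesis orthW : (row_mx Wl We)^T *m row_mx Wl We = 1%:M.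
Hypothesis svd : A^T *m A =
  Wl *m diag_mx dl ^+ 2 *m Wl^T + We *m diag_mx de ^+ 2 *m We^T.

Lemma svd_intertwine_l c :
  Wl^T *m (c *: (A^T *m A)) = (c *: diag_mx dl ^+ 2) *m Wl^T.
Proof.
have [Wll Wle _ _] := orthW_blocks orthW.
rewrite -scalemxAr -scalemxAl svd mulmxDr !mulmxA Wll Wle.
by rewrite !mul0mx addr0 mul1mx.
Qed.

Lemma svd_intertwine_e c :
  We^T *m (c *: (A^T *m A)) = diag_mx (\row_i (c * de 0 i ^+ 2)) *m We^T.
Proof.
have [_ _ Wel Wee] := orthW_blocks orthW.
rewrite -scalemxAr svd mulmxDr !mulmxA Wee Wel.
rewrite !mul0mx add0r mul1mx scalemxAl mulmx_diag.
congr (_ *m _); apply/matrixP => i j; rewrite !mxE expr2.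
by case: eqP => _; rewrite ?mulr1n ?mulr0n ?mulr0.
Qed.

Lemma dot_diag_mx p (d : 'rV[R]_p) (u : 'cV[R]_p) :
  dot u (diag_mx d *m (diag_mx d *m u)) =
    \sum_i d 0 i ^+ 2 * u i 0 ^+ 2.
Proof.
rewrite mulmxA mulmx_diag; apply: eq_bigr => i _.
by rewrite mul_diag_mx !mxE; ring.
Qed.

Lemma dot_image v : dot (A *m v) (A *m v) =
  \sum_i dl 0 i ^+ 2 * (Wl^T *m v) i 0 ^+ 2 +
  \sum_i de 0 i ^+ 2 * (We^T *m v) i 0 ^+ 2.
Proof.
rewrite dot_adjl mulmxA svd mulmxDl dotDr -!mulmxA !(dot_adjr _ _ v).
by rewrite !dot_diag_mx.
Qed.

Lemma opnorm_le s : 0 <= s -> (forall i, 0 <= dl 0 i <= s) ->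
  (forall i, 0 <= de 0 i <= s) -> opnorm A <= s.
Proof.
move=> s0 dl_le de_le; apply: ge_sup.
  by exists (enorm (A *m 0)), 0 => //=; rewrite enormE dot0l sqrtr0.
move=> _ [v /= v1 <-]; rewrite -[s]mulr1.
apply: le_trans (ler_wpM2l s0 v1); apply: ler_enorm => //.
rewrite dot_image (dot_split orthW v) mulrDr /dot !mulr_sumr.
by apply: lerD; apply: ler_sum => i _;
  [have /andP[? ?] := dl_le i | have /andP[? ?] := de_le i];
  rewrite -!expr2 ler_wpM2r ?sqr_ge0 // lerXn2r ?nnegrE.
Qed.

Lemma image_ge s v : 0 <= s -> (forall i, s <= dl 0 i) ->
  s * enorm (Wl^T *m v) <= enorm (A *m v).
Proof.
move=> s0 s_le.
rewrite -ler_sqr ?nnegrE ?mulr_ge0 ?enorm_ge0 // exprMn !enorm_sqr dot_image.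
apply: ler_wpDr; first by apply: sumr_ge0 => i _; rewrite mulr_ge0 ?sqr_ge0.
rewrite /dot mulr_sumr; apply: ler_sum => i _.
by rewrite -expr2 ler_wpM2r ?sqr_ge0 // lerXn2r ?nnegrE // (le_trans s0).
Qed.

End TruncatedSVD.

(** * The bound on the tolerance *)

(** When a = 0 the inverse is +oo and the product can exceed t only if x is
positive, since 0 times +oo is 0; so the real inequality covers this case. *)
Lemma tol_condition (R : realType) (a t x : R) : 0 <= a -> 0 < t ->
  (t%:E < a%:E^-1 * x%:E)%E -> a * t < x.
Proof.
rewrite le_eqVlt => /predU1P[<-|a0] t0; rewrite inver.
  rewrite eqxx mul0r; have [//|x0|<-] := ltgtP 0 x; last first.
    by rewrite mule0 lte_fin ltNge (ltW t0).
  by rewrite lt0_mulye // lte_fin.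
by rewrite gt_eqF // -EFinM lte_fin ltr_pdivlMl.
Qed.

(** The hypothesis for all n cycles implies its analogue for the first m,
because t, s and D grow with the number of cycles. *)
Lemma gap_denominator_gt0 (R : realType) (m n : nat) (t tn s sn D Dn k : R) :
  (1 < m <= n)%N -> 0 <= k -> t <= tn -> s <= sn -> 0 <= tn -> 0 <= sn ->
  D <= Dn ->
  tn * k + sn < (1 - Dn) / (n%:R - 1) ->
  D < 1 /\ 0 < 1 - (m%:R - 1) * ((t * k + s) / (1 - D)).
Proof.
move=> /andP[m1 mn] k0 ttn ssn tn0 sn0 DDn.
have m1' : 0 < m%:R - 1 :> R by rewrite subr_gt0 ltr1n.
have mn' : m%:R - 1 <= n%:R - 1 :> R by rewrite lerD2r ler_nat.
have n1' : 0 < n%:R - 1 :> R := lt_le_trans m1' mn'.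
have tk : t * k <= tn * k by rewrite ler_wpM2r.
rewrite ltr_pdivlMr // => h.
have h0 : 0 <= tn * k by rewrite mulr_ge0.
have h1 : 0 <= (tn * k + sn) * (n%:R - 1).
  by apply: mulr_ge0; [apply: addr_ge0 | apply: ltW].
have D1 : 0 < 1 - D by lra.
split; first by rewrite -subr_gt0.
rewrite subr_gt0 mulrA ltr_pdivrMr // mul1r.
have : (m%:R - 1) * (t * k + s) <= (m%:R - 1) * (tn * k + sn).
  by rewrite ler_wpM2l ?(ltW m1') // lerD.
have : (m%:R - 1) * (tn * k + sn) <= (n%:R - 1) * (tn * k + sn).
  by rewrite ler_wpM2r // addr_ge0.
lra.
Qed.

(** * The error bound *)

Theorem theorem4p4 (R : realType) (M l n : nat)
  (hl : (0 < l)%N) (hn : (0 < n)%N)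
  (A : 'M[R]_(M, l + n)) (hA : A != 0)
  (sigma : nat -> R) (hsigma : singular_values A sigma)
  (hgap : sigma l.+1 < sigma l)
  (Wl : 'M[R]_(l + n, l)) (We : 'M[R]_(l + n, n))
  (hW : (row_mx Wl We)^T *m row_mx Wl We = 1%:M)
  (Sl : 'M[R]_l) (hSl : Sl = diag_mx (\row_(i < l) sigma i.+1))
  (Se : 'M[R]_n) (hSe : Se = diag_mx (\row_(i < n) sigma (l + i).+1))
  (hAW : A^T *m A = Wl *m Sl ^+ 2 *m Wl^T + We *m Se ^+ 2 *m We^T)
  (kappa eps : R)
  (hkappa : kappa = sigma 1%N / sigma l) (heps : eps = sigma l.+1 / sigma 1%N)
  (tol : R) (htol : 0 < tol)
  (yhat y x xt xc : nat -> 'cV[R]_(l + n)) (it : nat -> nat)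
  (hrun : lsqrns_run A tol n yhat y x xt xc it)
  (psi psih : nat -> {poly R})
  (hpsi : forall j, (1 <= j <= n)%N ->
     minimal_residual_poly (sigma 1%N ^- 2 *: (A^T *m A)) (y j) (it j) (psi j))
  (hpsih : forall j, (1 <= j <= n)%N ->
     minimal_residual_poly (sigma 1%N ^- 2 *: Sl ^+ 2) (Wl^T *m y j) (it j)
       (psih j))
  (vartheta delta : nat -> R)
  (hvartheta : forall m, (1 <= m <= n)%N ->
     vartheta m = \big[Num.max/0]_(1 <= j < m.+1) vector_angle Wl (y j))
  (hdelta : forall m, (1 <= m <= n)%N ->
     delta m = \big[Num.max/0]_(1 <= j < m.+1) Delta eps (psi j) (psih j))
  (hvartheta_lt : vartheta n < pi / 2)
  (hdelta_le : delta n * eps ^+ 2 <= 1)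
  (* in \bar R, 0^-1 = +oo *)
  (htol_lt : (1 < n)%N ->
     (tol%:E < (kappa * tan (vartheta n))%:E^-1 *
       ((1 - delta n * eps ^+ 2) / (n%:R - 1)
          - 2 * Num.sqrt (delta n) * eps)%:E)%E) :
  forall m : nat, (1 <= m <= n)%N ->
  forall theta : nat -> R, canonical_angles We (basis_mx xc m) theta ->
    fnorm (sin_angles m theta) <=
      Num.sqrt m%:R * kappa * tol /
      Num.sqrt (1 - (m%:R - 1) *
        (tan (vartheta m) / (1 - delta m * eps ^+ 2) * kappa * tol
         + 2 * Num.sqrt (delta m) * eps / (1 - delta m * eps ^+ 2))).
Proof.
move=> m /andP[m_gt0 m_le_n] theta angles.
have le_sigma j k : (1 <= j <= k)%N -> (k <= l + n)%N -> sigma k <= sigma j.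
  by move=> /andP[j1 jk] kN; case: hsigma => _ + _; apply.
have sigma_ge0 k : (1 <= k <= l + n)%N -> 0 <= sigma k.
  by case: hsigma => + _ _; apply.
have sl1_ge0 : 0 <= sigma l.+1 by rewrite sigma_ge0 //= -addn1 leq_add2l.
have sl_gt0 : 0 < sigma l := le_lt_trans sl1_ge0 hgap.
have s1_gt0 : 0 < sigma 1%N.
  by apply: lt_le_trans sl_gt0 _; rewrite le_sigma ?hl ?leq_addr.
have kappa_gt0 : 0 < kappa by rewrite hkappa divr_gt0.
have eps_ge0 : 0 <= eps by rewrite heps divr_ge0 // ltW.
have k_ge0 : 0 <= kappa * tol by rewrite mulr_ge0 ?ltW.
pose c : R := sigma 1%N ^- 2.
have c_neq0 : c != 0 by rewrite invr_neq0 // expf_neq0 // gt_eqF.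
subst Sl Se.
have in_l (i : 'I_l) : (i.+1 <= l + n)%N.
  by rewrite (leq_trans (ltn_ord i)) ?leq_addr.
have in_e (i : 'I_n) : ((l + i).+1 <= l + n)%N by rewrite -addnS leq_add2l.
have opnormA : opnorm A <= sigma 1%N.
  apply: (opnorm_le hW hAW (ltW s1_gt0)) => i.
    by rewrite mxE sigma_ge0 ?le_sigma ?in_l.
  by rewrite mxE sigma_ge0 ?le_sigma ?in_e.
have imageA v : sigma l * enorm (Wl^T *m v) <= enorm (A *m v).
  apply: (image_ge hAW) => [|i]; first exact: ltW.
  by rewrite mxE le_sigma ?ltn_ord ?leq_addr.
(* What one cycle provides: the final iterate is the minimal residual vector,
   and the stopping test bounds its component along Wl. *)
have run j : (1 <= j <= n)%N -> [/\ dot (y j) (y j) = 1,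
    xt j = normalize (mxpoly (psi j) (c *: (A^T *m A)) *m y j),
    dot (xt j) (xt j) = 1 & enorm (Wl^T *m xt j) <= kappa * tol].
  move=> jn; have [d0 yE [_ iterx [x0 stop] _] xtE _] := hrun _ jn.
  have xE := lsqrnv_iterateE c_neq0 iterx (hpsi _ jn).
  split; [by rewrite yE dot_normalize | by rewrite xtE xE | |].
    by rewrite xtE dot_normalize.
  have ex0 : 0 < enorm (x j) by rewrite enorm_gt0.
  rewrite xtE /normalize -scalemxAr enormZ gtr0_norm ?invr_gt0 //.
  rewrite ler_pdivrMl // hkappa -(ler_pM2l sl_gt0).
  rewrite (le_trans (imageA _)) // (le_trans stop) //.
  have -> : sigma l * (enorm (x j) * (sigma 1%N / sigma l * tol)) =
      sigma 1%N * enorm (x j) * tol by field; rewrite gt_eqF.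
  by rewrite ler_wpM2r ?(ltW htol) // ler_wpM2r // ltW.
have xcE j : (1 <= j <= n)%N -> xc j = normalize (deflation xc j.-1 *m xt j).
  by move=> /hrun [].
have vt_ge j k : (1 <= j <= k)%N -> (k <= n)%N ->
    vector_angle Wl (y j) <= vartheta k.
  move=> /andP[j1 jk] kn; rewrite hvartheta ?(leq_trans j1) //.
  by apply: (@le_bigmax_seq _ _ _ _ 0 j) => //; rewrite mem_index_iota j1.
have delta_ge j k : (1 <= j <= k)%N -> (k <= n)%N ->
    Delta eps (psi j) (psih j) <= delta k.
  move=> /andP[j1 jk] kn; rewrite hdelta ?(leq_trans j1) //.
  apply: (@le_bigmax_seq _ _ _ _ 0 j xpredT
    (fun j => Delta eps (psi j) (psih j))) => //.
  by rewrite mem_index_iota j1.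
have mn : (1 <= m <= n)%N by rewrite m_gt0.
have nn : (1 <= n <= n)%N by rewrite hn /=.
have vt_ge0 : 0 <= vartheta m by rewrite hvartheta // bigmax_ge_id.
have vt_mono : vartheta m <= vartheta n.
  by rewrite !hvartheta //; apply: le_bigmax_nat.
have delta_mono : delta m <= delta n.
  by rewrite !hdelta //; apply: le_bigmax_nat.
have pi2 : 0 < pi / 2 :> R by rewrite divr_gt0 // pi_gt0.
have vt_lt : vartheta m < pi / 2 := le_lt_trans vt_mono hvartheta_lt.
have tan_mono : tan (vartheta m) <= tan (vartheta n).
  by apply: ler_tan => //; lra.
have tan_ge0 : 0 <= tan (vartheta m).
  by rewrite -(tan0 R); apply: ler_tan => //; lra.
pose D := delta m * eps ^+ 2.
pose beta := (tan (vartheta m) * (kappa * tol) + 2 * Num.sqrt D) / (1 - D).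
have sqrtD k : Num.sqrt (delta k * eps ^+ 2) = Num.sqrt (delta k) * eps.
  by rewrite mulrC sqrtrM ?sqr_ge0 // sqrtr_sqr ger0_norm // mulrC.
have betaE : tan (vartheta m) / (1 - D) * kappa * tol
    + 2 * Num.sqrt (delta m) * eps / (1 - D) = beta.
  by rewrite /beta sqrtD; ring.
rewrite -/D betaE; set mu := 1 - _ * beta.
have gap : (1 < m)%N -> D < 1 /\ 0 < mu.
  move=> m1; have n1 := leq_trans m1 m_le_n.
  have tann0 := le_trans tan_ge0 tan_mono.
  have := tol_condition (mulr_ge0 (ltW kappa_gt0) tann0) htol (htol_lt n1).
  rewrite ltrBrDr => h.
  apply: (@gap_denominator_gt0 _ m n _ (tan (vartheta n)) _
    (2 * Num.sqrt (delta n * eps ^+ 2)) D (delta n * eps ^+ 2)) => //.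
  - by rewrite m1.
  - by rewrite ler_wpM2l // ler_wsqrtr // ler_wpM2r ?sqr_ge0.
  - by rewrite ler_wpM2r ?sqr_ge0.
  - rewrite sqrtD; apply: le_lt_trans h; rewrite le_eqVlt; apply/orP; left.
    by apply/eqP; ring.
(* For m = 1 no two vectors have to be compared and mu = 1. *)
have mu_gt0 : 0 < mu.
  have := m_gt0; rewrite leq_eqVlt => /predU1P[m1|/gap[]//].
  by rewrite /mu -m1 subrr mul0r subr0.
have overlap j k : (1 <= j < k)%N -> (k <= m)%N -> `|dot (xt j) (xt k)| <= beta.
  move=> /andP[j1 jk] km.
  have jm : (j <= m)%N := leq_trans (ltnW jk) km.
  have kn : (1 <= k <= n)%N by rewrite (leq_trans _ jk) // (leq_trans km).
  have jn : (1 <= j <= n)%N by rewrite j1 (leq_trans jm).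
  have [D1 _] := gap (leq_trans (leq_ltn_trans j1 jk) km).
  have [y1 xtkE _ _] := run k kn; have [_ _ xtj1 xtj_le] := run j jn.
  have km' : (1 <= k <= m)%N by rewrite km andbT; case/andP: kn.
  have [h0 gh] := vector_angle_tan hW y1 (vt_ge k m km' m_le_n) vt_lt.
  have := delta_ge k m km' m_le_n; rewrite ge_max => /andP[psi_le psih_le].
  (* The start vector y_k has been deflated against the basis that spans the
     earlier xt_j. *)
  have orth : dot (xt j) (y k) = 0.
    have [_ yE _ _ _] := hrun _ kn.
    have k1n : (k.-1 <= n)%N.
      by rewrite (leq_trans (leq_pred k)) //; case/andP: kn.
    apply: (orth_gram_schmidt xcE k1n) => [i ik|]; last first.
      by rewrite j1 -ltnS prednK //; case/andP: kn.
    rewrite yE dotZr deflation_orth ?mulr0 //.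
    exact: (gram_schmidt_weak_orthonormal xcE).
  rewrite xtkE.
  apply: (overlap_bound hW (svd_intertwine_l hW hAW c)
    (svd_intertwine_e hW hAW c) (b := eps ^+ 2) _
    (hpsi _ kn) (hpsih _ kn)) => //.
  - move=> i; rewrite !mxE heps exprMn exprVn mulrC -/c.
    have c_ge0 : 0 <= c by rewrite invr_ge0 sqr_ge0.
    rewrite mulr_ge0 ?sqr_ge0 //= ler_wpM2r // lerXn2r ?nnegrE //.
      by rewrite sigma_ge0 ?in_e.
    by rewrite le_sigma ?in_e //= ltnS leq_addr.
  - exact: sqr_ge0.
have unit (i : 'I_m) : dot (xt i.+1) (xt i.+1) = 1.
  by have [] := run i.+1 (leq_trans (ltn_ord i) m_le_n).
have offdiag (i j : 'I_m) : i != j -> `|dot (xt i.+1) (xt j.+1)| <= beta.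
  rewrite neq_ltn => /orP[ij|ji]; first by rewrite overlap ?ltn_ord.
  by rewrite dotC overlap ?ltn_ord.
have lower (z : 'cV[R]_m) :
    mu * dot z z <= dot (basis_mx xt m *m z) (basis_mx xt m *m z).
  by rewrite mul_basis_mx; apply: gershgorin.
have [X1 stable] := gram_schmidt_stable xcE m_le_n mu_gt0 lower.
have := stable _ Wl^T.
rewrite -(fnorm_sin_angles (orthW_complete hW) X1 angles) => h.
have Xt_le : fnorm (Wl^T *m basis_mx xt m) ^+ 2 <= m%:R * (kappa * tol) ^+ 2.
  rewrite fnorm_sqr mulr_natl -[m in leRHS]card_ord -sumr_const.
  apply: ler_sum => j _.
  have [_ _ _ xt_le] := run j.+1 (leq_trans (ltn_ord j) m_le_n).
  rewrite colE -mulmxA -colE col_basis_mx -enorm_sqr.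
  by rewrite lerXn2r ?nnegrE ?enorm_ge0.
rewrite ler_pdivlMr ?sqrtr_gt0 // -mulrA.
rewrite -ler_sqr ?nnegrE; [|by rewrite mulr_ge0 ?sqrtr_ge0..].
rewrite [leLHS]exprMn [leRHS]exprMn (sqr_sqrtr (ltW mu_gt0)) mulrC.
rewrite (sqr_sqrtr (ler0n R m)).
exact: le_trans h Xt_le.
Qed.
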